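(* Let $(A,B,C)$ be given, together with a set $\mathcal K$ of possible communications between sensors and actuators and a collection of possible communication failures $\{\Gamma_i\}_{i\in\Delta}$ with $\Gamma_i\subset\mathcal K$. If the sequence $\operatorname{trace}(Y_kX_{k+1}+X_kY_{k+1})$ generated by Algorithm 1 (described in the context) converges to $2N$, then Algorithm 1 determines a matrix $K$, with $K\in[\bar K(\mathcal K)]^{\Gamma_i}$ for $i\in\Delta$, such that the $N\times N$ matrix $\tilde A(K)=\begin{bmatrix} A & B \\ C & K \end{bmatrix}$ is Schur.
   Context: $A\in\mathbb R^{n\times n}$, $B\in\mathbb R^{n\times p}$, $C\in\mathbb R^{p\times n}$, $K\in\mathbb R^{p\times p}$ (the numbers of actuators and sensors are equal, so that $\tilde A(K)$ is square), and $N=n+p$. $\mathcal K$ is a set of pairs (sensor, actuator): $(j,i)\in\mathcal K$ means sensor $j$ can communicate to actuator $i$. $\bar K(\mathcal K)$ is the binary matrix with $\bar K_{i,j}=1$ if $(j,i)\in\mathcal K$ and $0$ otherwise, and for $\Gamma\subset\mathcal K$, $[\bar K(\mathcal K)]^{\Gamma}=\{K\in\mathbb R^{p\times p}:K_{l,s}=0\text{ if }(s,l)\notin\mathcal K\text{ or }(s,l)\in\Gamma\}$. $\mathbb S^N_+$ is the set of real symmetric positive semidefinite $N\times N$ matrices; $\succ0$, $\succeq0$ mean positive definite, semidefinite. A square matrix is Schur if all its eigenvalues lie in the open unit disc. Algorithm 1. Step 1: find feasible points $X_0,Y_0\in\mathbb S^N_+$ and $K_0\in[\bar K(\mathcal K)]^{\Gamma_i}$,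 $i\in\Delta$, satisfying the constraints $\begin{bmatrix} X & \tilde A(K)^\top \\ \tilde A(K) & Y \end{bmatrix}\succ0$, $X=Y^{-1}$; if no feasible point exists, stabilization with these information pattern constraints is declared impossible. Step 2: at iteration $k$, from $X_k,Y_k$ obtain $X_{k+1},Y_{k+1},K_{k+1}$ as a solution $(X,Y,K)$ of $$\min_{K\in[\bar K(\mathcal K)]^{\Gamma_i},\,i\in\Delta;\ X,Y\in\mathbb S^N_+}\operatorname{trace}(Y_kX+X_kY)\quad\text{s.t.}\quad\begin{bmatrix} X & \tilde A(K)^\top \\ \tilde A(K) & Y \end{bmatrix}\succ0,\quad\begin{bmatrix} X & I \\ I & Y \end{bmatrix}\succeq0.$$ Step 3: if $\tilde A(K_{k+1})$ is Schur, with $K_{k+1}\in[\bar K(\mathcal K)]^{\Gamma_i}$, $i\in\Delta$, stop (output $K_{k+1}$); otherwise set $k\leftarrow k+1$ and go to Step 2. *)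

(* Defs.v *)
From HB Require Import structures.
From mathcomp Require Import all_boot all_order all_algebra.
From mathcomp Require Import all_classical all_reals all_analysis.
From mathcomp Require Import complex.

Set Implicit Arguments.
Unset Strict Implicit.
Unset Printing Implicit Defensive.

Import Order.TTheory GRing.Theory Num.Theory.
Import numFieldNormedType.Exports.

Local Open Scope classical_set_scope.
Local Open Scope ring_scope.

Section MatrixNotions.
Context {R : realType}.

Definition psdmx m (M : 'M[R]_m) : Prop :=
  M^T = M /\ forall v : 'cV[R]_m, 0 <= (v^T *m M *m v) 0 0.

Definition pdmx m (M : 'M[R]_m) : Prop :=
  M^T = M /\ forall v : 'cV[R]_m, v != 0 -> 0 < (v^T *m M *m v) 0 0.

(* The eigenvalues are the complex ones: [M] is first mapped into [R[i]]. *)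
Definition schur_stable m (M : 'M[R]_m) : Prop :=
  forall z : R[i],
    eigenvalue (map_mx (real_complex R) M) z -> `|z| < 1.

(* Channels are ordered (sensor, actuator), whereas the gain of the channel
   (s, l) is the entry in row l (actuator) and column s (sensor). *)
Definition structured p (KK Gam : {set 'I_p * 'I_p}) : set 'M[R]_p :=
  [set K | forall l s : 'I_p,
     (s, l) \notin KK \/ (s, l) \in Gam -> K l s = 0].

End MatrixNotions.

Section Algorithm.
Context {R : realType} {n p : nat}.
Variables (A : 'M[R]_n) (B : 'M[R]_(n, p)) (C : 'M[R]_(p, n)).
Variables (KK : {set 'I_p * 'I_p}).
Variables (Delta : Type) (Gam : Delta -> {set 'I_p * 'I_p}).

Definition Atilde (K : 'M[R]_p) : 'M[R]_(n + p) := block_mx A B C K.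

Definition admissible (K : 'M[R]_p) : Prop :=
  forall i : Delta, structured KK (Gam i) K.

Definition stability_lmi (X Y : 'M[R]_(n + p)) (K : 'M[R]_p) : Prop :=
  pdmx (block_mx X (Atilde K)^T (Atilde K) Y).

(* [invmx Y] is [Y] itself when [Y] is singular, hence the [unitmx] clause. *)
Definition step1 (X Y : 'M[R]_(n + p)) (K : 'M[R]_p) : Prop :=
  [/\ psdmx X, psdmx Y, admissible K, stability_lmi X Y K
    & Y \in unitmx /\ X = invmx Y].

Definition step2_feasible (X Y : 'M[R]_(n + p)) (K : 'M[R]_p) : Prop :=
  [/\ psdmx X, psdmx Y, admissible K, stability_lmi X Y K
    & psdmx (block_mx X 1%:M 1%:M Y)].

Definition objective (Xk Yk X Y : 'M[R]_(n + p)) : R :=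
  \tr (Yk *m X + Xk *m Y).

Definition step2_solution (Xk Yk X Y : 'M[R]_(n + p)) (K : 'M[R]_p) : Prop :=
  step2_feasible X Y K /\
  forall X' Y' K', step2_feasible X' Y' K' ->
    objective Xk Yk X Y <= objective Xk Yk X' Y'.

Definition step3_stop (K : 'M[R]_p) : Prop :=
  admissible K /\ schur_stable (Atilde K).

(* Iteration [k] is carried out only if the stopping test failed at all the
   earlier iterations, so the values of the sequences past the stopping
   iteration, if there is one, are irrelevant padding. *)
Definition algorithm1_run (X Y : nat -> 'M[R]_(n + p)) (K : nat -> 'M[R]_p) :
    Prop :=
  step1 (X 0%N) (Y 0%N) (K 0%N) /\
  forall k : nat,
    (forall j : nat, (j < k)%N -> ~ step3_stop (K j.+1)) ->
    step2_solution (X k) (Y k) (X k.+1) (Y k.+1) (K k.+1).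

Definition algorithm1_output (K : nat -> 'M[R]_p) (Kout : 'M[R]_p) : Prop :=
  exists k : nat,
    [/\ forall j : nat, (j < k)%N -> ~ step3_stop (K j.+1),
        step3_stop (K k.+1)
      & Kout = K k.+1].

End Algorithm.

(* Main.v *)
(* Since X0 = Y0^-1, the starting point is feasible for the first problem of
   Step 2, with objective value 2N.  Conversely, the objective minus 2N is the
   trace of the product of S = [X I; I Y] with [Y0 -I; -I X0] = W X0 W^T, where
   W = [Y0; -I]; it is nonnegative because S is positive semidefinite, and it
   vanishes only if S W = 0, i.e. Y = Y0 and X = Y0^-1.  Hence the first
   iterate satisfies X1 = Y1^-1, the stability LMI turns into the Lyapunov
   inequality Y1 - At Y1 At^T > 0 for At = Atilde K1, and the algorithm stops
   at its first iteration. *)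
Require Import Defs.
From HB Require Import structures.
From mathcomp Require Import all_boot all_order all_algebra.
From mathcomp Require Import all_classical all_reals all_analysis.
From mathcomp Require Import complex.
From mathcomp Require Import ring lra.

Set Implicit Arguments.
Unset Strict Implicit.
Unset Printing Implicit Defensive.

Import Order.TTheory GRing.Theory Num.Theory.
Import numFieldNormedType.Exports.

Local Open Scope classical_set_scope.
Local Open Scope ring_scope.

(** * Quadratic forms, traces and definite matrices *)

Lemma col_mulmx (R : pzSemiRingType) m k l (M : 'M[R]_(m, k))
    (N : 'M[R]_(k, l)) j :
  col j (M *m N) = M *m col j N.
Proof.
by apply/colP => i; rewrite !mxE; apply: eq_bigr => h _; rewrite !mxE.
Qed.

Lemma mxtrace_quadratic (R : pzRingType) m k (S : 'M[R]_m) (M : 'M[R]_(m, k)) :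
  \tr (M^T *m S *m M) = \sum_i ((col i M)^T *m S *m col i M) 0 0.
Proof.
rewrite /mxtrace; apply: eq_bigr => i _.
by rewrite tr_col -row_mul -col_mulmx !mxE; apply: eq_bigr => h _; rewrite !mxE.
Qed.

Lemma quadratic_block (R : comNzRingType) m k (P : 'M[R]_m) (Q : 'M[R]_(m, k))
    (T : 'M[R]_k) (x : 'cV[R]_m) (y : 'cV[R]_k) :
  ((col_mx x y)^T *m block_mx P Q Q^T T *m col_mx x y) 0 0 =
  (x^T *m P *m x) 0 0 + (x^T *m Q *m y) 0 0 *+ 2 + (y^T *m T *m y) 0 0.
Proof.
rewrite tr_col_mx mul_row_block mul_row_col !mulmxDl.
have -> : y^T *m Q^T *m x = (x^T *m Q *m y)^T.
  by rewrite !trmx_mul trmxK mulmxA.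
by rewrite !mxE; ring.
Qed.

(** Perturb [v] along [w = S *m v]: the form at [v + t *: w] is a quadratic polynomial in [t] whose
    linear coefficient is twice the squared norm of [w]. If [w] were nonzero, a small negative [t]
    would make the form negative. *)
Lemma psdmx_ker (R : realType) m (S : 'M[R]_m) (v : 'cV[R]_m) :
  psdmx S -> (v^T *m S *m v) 0 0 <= 0 -> S *m v = 0.
Proof.
move=> [symS posS] qv; pose w := S *m v.
pose s := (w^T *m w) 0 0; pose c := (w^T *m S *m w) 0 0.
have sE : s = \sum_i w i 0 ^+ 2.
  by rewrite /s mxE; apply: eq_bigr => i _; rewrite mxE expr2.
have s0 : 0 <= s by rewrite sE sumr_ge0// => i _; rewrite sqr_ge0.
have c0 : 0 <= c by apply: posS.
have qE t : ((v + t *: w)^T *m S *m (v + t *: w)) 0 0 =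
    (v^T *m S *m v) 0 0 + t * s *+ 2 + t ^+ 2 * c.
  have vSw : v^T *m S *m w = w^T *m w by rewrite /w trmx_mul symS.
  have wSv : w^T *m S *m v = w^T *m w by rewrite -mulmxA.
  have -> : (v + t *: w)^T = v^T + t *: w^T by rewrite linearD linearZ.
  rewrite !mulmxDl !mulmxDr -!scalemxAl -!scalemxAr vSw wSv.
  rewrite ![((_ + _ : 'M[R]_1) _ _)]mxE ![((_ *: _ : 'M[R]_1) _ _)]mxE.
  by rewrite -/s -/c; ring.
have s00 : s = 0.
  apply/eqP; rewrite eq_le s0 andbT leNgt; apply/negP => spos.
  (* The minimizer would be [- s / c]; the denominator [c + 1] also covers [c = 0]. *)
  have := posS (v + (- s / (c + 1)) *: w); rewrite qE.
  have c1 : 0 < c + 1 by lra.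
  have tE : - s / (c + 1) * s *+ 2 + (- s / (c + 1)) ^+ 2 * c =
      - (s ^+ 2 * (c + 2) / (c + 1) ^+ 2) by field; rewrite gt_eqF.
  have : 0 < s ^+ 2 * (c + 2) / (c + 1) ^+ 2.
    by rewrite divr_gt0 ?mulr_gt0 ?exprn_gt0//; lra.
  lra.
apply/matrixP => i j; rewrite ord1 [RHS]mxE; apply/eqP.
rewrite -/w -sqrf_eq0; apply/eqP.
move: s00; rewrite sE => /psumr_eq0P; apply => // k _.
exact: sqr_ge0.
Qed.

(** Induction on the size, peeling off the first row and column: the Schur complement of a positive
    pivot is again positive definite. The factor [L] serves to turn a trace against [P] into a sum
    of quadratic forms. *)
Lemma pdmx_cholesky (R : realType) m (P : 'M[R]_m) :
  pdmx P -> exists2 L : 'M[R]_m, L \in unitmx & P = L *m L^T.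
Proof.
elim: m P => [|m IH] P.
  by move=> _; exists 1%:M; [exact: unitmx1 | apply/matrixP => - []].
rewrite -[m.+1]/(1 + m)%N in P *; move=> [symP posP].
pose a := P 0 0; pose b := dlsubmx P; pose D := drsubmx P.
have PE : P = block_mx a%:M b^T b D.
  rewrite -[P in LHS]submxK; congr block_mx.
    by rewrite [LHS]mx11_scalar !mxE lshift0.
  by rewrite /b trmx_dlsub symP.
have bE : block_mx a%:M b^T b D = block_mx a%:M b^T b^T^T D by rewrite trmxK.
have symD : D^T = D by rewrite /D trmx_drsub symP.
have a0 : 0 < a.
  have := posP (col_mx 1%:M 0); rewrite PE bE quadratic_block.
  rewrite trmx1 !mul1mx mulmx1 !mulmx0 ![(0 : 'M[R]_(_, _)) _ _]mxE !mxE.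
  rewrite mul0rn !addr0 mulr1n; apply.
  by rewrite col_mx_eq0 negb_and oner_neq0.
have an0 : a != 0 by rewrite gt_eqF.
have [|L Lu LE] := IH (D - a^-1 *: (b *m b^T)).
  split; first by rewrite linearB linearZ /= trmx_mul trmxK symD.
  (* This top entry minimizes the form of [P] for fixed [y], and the minimum is the form of the
     Schur complement at [y]. *)
  move=> y y0; have := posP (col_mx (- a^-1 *: (b^T *m y)) y).
  rewrite col_mx_eq0 negb_and y0 orbT => /(_ isT).
  rewrite PE bE quadratic_block.
  set x := b^T *m y.
  have xE : y^T *m (D - a^-1 *: (b *m b^T)) *m y =
      y^T *m D *m y - a^-1 *: (x^T *m x).
    rewrite mulmxBr mulmxBl -scalemxAr -scalemxAl /x trmx_mul trmxK.
    by rewrite !mulmxA.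
  have -> : (- a^-1 *: x)^T = - a^-1 *: x^T by rewrite linearZ.
  rewrite xE -!mulmxA -/x mul_scalar_mx -!scalemxAl -!scalemxAr.
  rewrite ![((_ + _ : 'M[R]_1) _ _)]mxE ![((- _ : 'M[R]_1) _ _)]mxE.
  rewrite ![((_ *: _ : 'M[R]_1) _ _)]mxE => h.
  apply: (lt_le_trans h); rewrite le_eqVlt; apply/orP; left; apply/eqP.
  by field.
have l2 : Num.sqrt a * Num.sqrt a = a by rewrite -expr2 sqr_sqrtr// ltW.
have l0 : Num.sqrt a != 0 by rewrite sqrtr_eq0 -ltNge.
exists (block_mx (Num.sqrt a)%:M 0 ((Num.sqrt a)^-1 *: b) L).
  rewrite unitmxE det_lblock det_scalar1 unitrM -unitmxE Lu andbT.
  by rewrite unitfE.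
rewrite PE tr_block_mx mulmx_block !trmx0 tr_scalar_mx !mulmx0 !mul0mx !addr0.
rewrite -scalar_mxM l2 linearZ /= mul_scalar_mx scalerA mulfV// scale1r.
rewrite mul_mx_scalar scalerA mulfV// scale1r -scalemxAl -scalemxAr scalerA.
by rewrite -invfM l2 -LE addrC subrK.
Qed.

(** * The minimization problem around an exactly inverse pair *)

Lemma psdmx_block_inv (R : realType) m (X Y : 'M[R]_m) :
  psdmx X -> Y^T = Y -> X *m Y = 1%:M -> psdmx (block_mx X 1%:M 1%:M Y).
Proof.
move=> [symX posX] symY XY; have YX := mulmx1C XY.
have E : block_mx X 1%:M 1%:M Y = col_mx 1%:M Y *m X *m (col_mx 1%:M Y)^T.
  rewrite mul_col_mx tr_col_mx mul_col_row trmx1 symY.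
  by rewrite !mul1mx !mulmx1 XY YX mul1mx.
split; first by rewrite tr_block_mx !trmx1 symX symY.
move=> v; have := posX ((col_mx 1%:M Y)^T *m v).
by rewrite E trmx_mul trmxK !mulmxA.
Qed.

Lemma objective_inv (R : realType) n p (X Y : 'M[R]_(n + p)) :
  X *m Y = 1%:M -> objective X Y X Y = 2 * (n + p)%:R.
Proof.
move=> XY; rewrite /objective (mulmx1C XY) XY -mulr2n linearMn /= mxtrace1.
by rewrite mulr_natl.
Qed.

Lemma objective_inv_min (R : realType) n p (X0 Y0 X Y : 'M[R]_(n + p)) :
  pdmx X0 -> Y0^T = Y0 -> X0 *m Y0 = 1%:M ->
  psdmx (block_mx X 1%:M 1%:M Y) ->
  objective X0 Y0 X Y <= 2 * (n + p)%:R -> X = X0 /\ Y = Y0.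
Proof.
move=> pdX0 symY0 XY0 psdS obj_le; have YX0 := mulmx1C XY0.
have [L Lu X0E] := pdmx_cholesky pdX0.
set S := block_mx _ _ _ _ in psdS.
pose W := col_mx Y0 (- 1%:M).
have SWE : S *m W = col_mx (X *m Y0 - 1%:M) (Y0 - Y).
  by rewrite mul_block_col mul1mx !mulmxN !mulmx1 mul1mx.
(* By cyclicity the trace is that of [S *m W *m X0 *m W^T], whose diagonal blocks have the traces of
   [X *m Y0 - 1%:M] and [Y *m X0 - 1%:M]. *)
have trE : \tr ((W *m L)^T *m S *m (W *m L)) =
    objective X0 Y0 X Y - 2 * (n + p)%:R.
  rewrite mxtrace_mulC trmx_mul !mulmxA -(mulmxA W) -X0E mxtrace_mulC.
  rewrite !mulmxA SWE tr_col_mx linearN /= trmx1 symY0 mul_col_mx mul_col_row.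
  rewrite mxtrace_block -mulmxA XY0 mulmx1 mulmxN mulmx1 mulmxBl YX0.
  rewrite linearB /= linearN /= linearB /= mxtrace1 /objective linearD /=.
  by rewrite (mxtrace_mulC Y) (mxtrace_mulC X); ring.
(* The trace is a sum of nonnegative forms, one for each column of [W *m L]. It is at most 0, so
   every form vanishes and [S] kills every column. *)
have SWL0 : S *m (W *m L) = 0.
  have q0 i : 0 <= ((col i (W *m L))^T *m S *m col i (W *m L)) 0 0.
    by apply: psdS.2.
  have : \tr ((W *m L)^T *m S *m (W *m L)) = 0.
    apply/eqP; rewrite eq_le [in X in X && _]trE subr_le0 obj_le.
    by rewrite mxtrace_quadratic sumr_ge0.
  rewrite mxtrace_quadratic => /psumr_eq0P qi0.
  apply/matrixP => i j; rewrite [RHS]mxE.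
  have qj0 : ((col j (W *m L))^T *m S *m col j (W *m L)) 0 0 <= 0.
    by rewrite qi0// => k _; exact: q0.
  have /matrixP/(_ i 0) := psdmx_ker psdS qj0.
  by rewrite -col_mulmx !mxE.
have : S *m W = 0.
  by rewrite -[LHS](mulmxK Lu) -(mulmxA S) SWL0 mul0mx.
rewrite SWE => /eqP; rewrite col_mx_eq0 !subr_eq0 => /andP[/eqP XY /eqP->].
by split=> //; rewrite -[X]mulmx1 -YX0 mulmxA XY mul1mx.
Qed.

(** * From the matrix inequality to Schur stability *)

Lemma pdmx_block_ul (R : realType) m k (P : 'M[R]_m) (Q : 'M[R]_(m, k))
    (T : 'M[R]_k) :
  pdmx (block_mx P Q Q^T T) -> pdmx P.
Proof.
move=> [symS posS]; split.
  by move: symS; rewrite tr_block_mx => /eq_block_mx[].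
move=> x x0; have := posS (col_mx x 0); rewrite quadratic_block.
rewrite !mulmx0 ![(0 : 'M[R]_1) _ _]mxE mul0rn !addr0.
by apply; rewrite col_mx_eq0 negb_and x0.
Qed.

Lemma pdmx_block_dr (R : realType) m k (P : 'M[R]_m) (Q : 'M[R]_(m, k))
    (T : 'M[R]_k) :
  pdmx (block_mx P Q Q^T T) -> pdmx T.
Proof.
move=> [symS posS]; split.
  by move: symS; rewrite tr_block_mx => /eq_block_mx[].
move=> y y0; have := posS (col_mx 0 y); rewrite quadratic_block.
rewrite trmx0 !mul0mx !mxE mul0rn !add0r; apply.
by rewrite col_mx_eq0 negb_and y0 orbT.
Qed.

Lemma lmi_lyapunov (R : realType) m (M X Y : 'M[R]_m) (u : 'cV[R]_m) :
  pdmx (block_mx X M^T M Y) -> X *m Y = 1%:M -> u != 0 ->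
  ((M^T *m u)^T *m Y *m (M^T *m u)) 0 0 < (u^T *m Y *m u) 0 0.
Proof.
(* [quadratic_block] and [pdmx_block_dr] expect the lower left block as the transpose of the upper
   right one, here [M^T]. *)
rewrite -{2}[M]trmxK => lmi XY u0.
have [symY _] := pdmx_block_dr lmi.
(* With [x = M^T *m u], the upper block contributes [x^T Y x] since [X *m Y = 1%:M], and the cross
   terms contribute [- 2 x^T Y x]: what remains is the claimed difference. *)
have := lmi.2 (col_mx (- (Y *m (M^T *m u))) u).
rewrite col_mx_eq0 negb_and u0 orbT => /(_ isT).
set x := M^T *m u.
rewrite quadratic_block.
have -> : (- (Y *m x))^T = - (x^T *m Y) by rewrite linearN /= trmx_mul symY.
rewrite !mulNmx mulmxN opprK.
rewrite -!(mulmxA _ M^T u) -/x -!mulmxA (mulmxA X) XY mul1mx.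
by rewrite ![((- _ : 'M[R]_1) _ _)]mxE; lra.
Qed.

(** Eigenvectors here are row vectors, so [M^T] acts on their transposes, as in the Lyapunov
    inequality. For [v = a + i b], the Hermitian form of [Y] is the real number [q a + q b];
    applying [M^T] scales it by the squared modulus of the eigenvalue, yet strictly decreases it. *)
Lemma lmi_schur_stable (R : realType) m (M X Y : 'M[R]_m) :
  pdmx (block_mx X M^T M Y) -> X *m Y = 1%:M -> schur_stable M.
Proof.
move=> lmi XY [al be] /eigenvalueP[v vM v0].
have [symY posY] : pdmx Y by move: lmi; rewrite -{2}[M]trmxK => /pdmx_block_dr.
pose a : 'cV[R]_m := \col_i complex.Re (v 0 i).
pose b : 'cV[R]_m := \col_i complex.Im (v 0 i).
pose q (u : 'cV[R]_m) : R := (u^T *m Y *m u) 0 0.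
have aM : M^T *m a = al *: a - be *: b.
  apply/colP => i; have /rowP/(_ i)/(congr1 (@complex.Re R)) := vM.
  rewrite !mxE raddf_sum; case: (v 0 i) => x y /= <-.
  apply: eq_bigr => k _; rewrite !mxE; case: (v 0 k) => x' y' /=.
  by ring.
have bM : M^T *m b = be *: a + al *: b.
  apply/colP => i; have /rowP/(_ i)/(congr1 (@complex.Im R)) := vM.
  rewrite !mxE raddf_sum; case: (v 0 i) => x y /=.
  rewrite addrC => <-.
  apply: eq_bigr => k _; rewrite !mxE; case: (v 0 k) => x' y' /=.
  by ring.
have qE s t : q (s *: a + t *: b) =
    s ^+ 2 * q a + s * t * (a^T *m Y *m b) 0 0 *+ 2 + t ^+ 2 * q b.
  have bYa : (b^T *m Y *m a) 0 0 = (a^T *m Y *m b) 0 0.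
    have -> : b^T *m Y *m a = (a^T *m Y *m b)^T.
      by rewrite !trmx_mul trmxK symY mulmxA.
    by rewrite mxE.
  have trE : (s *: a + t *: b)^T = s *: a^T + t *: b^T.
    by rewrite linearD !linearZ.
  rewrite /q trE !mulmxDl !mulmxDr -!scalemxAl -!scalemxAr.
  rewrite ![((_ + _ : 'M[R]_1) _ _)]mxE ![((_ *: _ : 'M[R]_1) _ _)]mxE bYa.
  by ring.
have q_ge0 u : 0 <= q u.
  have [->|/posY/ltW//] := eqVneq u 0.
  by rewrite /q mulmx0 mxE.
have decr u : q (M^T *m u) <= q u.
  have [->|u0] := eqVneq u 0; first by rewrite mulmx0.
  exact/ltW/(lmi_lyapunov lmi XY).
(* The mixed terms in [a] and [b] have opposite signs and cancel. *)
have q_ab : q (al *: a - be *: b) + q (be *: a + al *: b) =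
    (al ^+ 2 + be ^+ 2) * (q a + q b).
  by rewrite -scaleNr !qE; ring.
have ab : (a != 0) || (b != 0).
  rewrite -negb_and; apply: contra v0 => /andP[/eqP a0 /eqP b0].
  apply/eqP/rowP => i; apply/eqP; rewrite mxE eq_complex.
  move/matrixP/(_ i 0) : a0; move/matrixP/(_ i 0) : b0.
  by rewrite !mxE => -> ->; rewrite !eqxx.
have [q_gt0 q_lt] : 0 < q a + q b /\
    q (al *: a - be *: b) + q (be *: a + al *: b) < q a + q b.
  (* Only one of [a], [b] is known to be nonzero: the strict decrease is used for it, the weak one
     for the other. *)
  rewrite -aM -bM; case/orP: ab => /[dup] h /posY qh; split.
  - by rewrite ltr_wpDr.
  - by apply: ltr_leD => //; exact: (lmi_lyapunov lmi XY).
  - by rewrite ltr_wpDl.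
  - by apply: ler_ltD => //; exact: (lmi_lyapunov lmi XY).
have nz : al ^+ 2 + be ^+ 2 < 1.
  by rewrite q_ab -{2}[q a + q b]mul1r ltr_pM2r in q_lt.
by rewrite normc_def /= -[1]/(real_complex R 1) ltcR -sqrtr1 ltr_sqrt.
Qed.

Theorem theorem6 (R : realType) (n p : nat)
    (A : 'M[R]_n) (B : 'M[R]_(n, p)) (C : 'M[R]_(p, n))
    (KK : {set 'I_p * 'I_p})
    (Delta : Type) (Gam : Delta -> {set 'I_p * 'I_p})
    (Gam_sub : forall i : Delta, Gam i \subset KK)
    (X Y : nat -> 'M[R]_(n + p)) (K : nat -> 'M[R]_p)
    (run : algorithm1_run A B C KK Gam X Y K)
    (trace_cvg :
       (fun k : nat => \tr (Y k *m X k.+1 + X k *m Y k.+1)) @ \oo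
         --> (2 * (n + p)%:R : R)) :
  exists Kout : 'M[R]_p,
    [/\ algorithm1_output A B C KK Gam K Kout,
        forall i : Delta, structured KK (Gam i) Kout
      & schur_stable (Atilde A B C Kout)].
Proof.
have [[psdX0 psdY0 adm0 lmi0 [Y0u X0E]] step] := run.
have XY0 : X 0%N *m Y 0%N = 1%:M by rewrite X0E mulVmx.
(* No iteration precedes iteration 0, so its premise holds vacuously. *)
have [[_ _ adm1 lmi1 psd1] min1] := step 0%N (fun j => ltac:(by [])).
have pdX0 : pdmx (X 0%N).
  by move: lmi0; rewrite /stability_lmi -{2}[Atilde _ _ _ _]trmxK
    => /pdmx_block_ul.
have [X1E Y1E] : X 1%N = X 0%N /\ Y 1%N = Y 0%N.
  apply: objective_inv_min => //; first exact: psdY0.1.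
  (* The minimizer is compared with the initial triple itself, including its gain [K 0%N]. *)
  rewrite -(objective_inv XY0); apply: (min1 _ _ (K 0%N)); split => //.
  exact: psdmx_block_inv psdX0 psdY0.1 XY0.
have stable1 : schur_stable (Atilde A B C (K 1%N)).
  by apply: lmi_schur_stable lmi1 _; rewrite X1E Y1E.
exists (K 1%N); split=> //.
(* Iteration 0 tests the gain of index 1. *)
by exists 0%N; split.
Qed.
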